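(* Let nine points $\mathbf{b}_{i0}\in\mathbb{R}^3$, $i=0,1,2,3,4$, and $\mathbf{b}_{i4}\in\mathbb{R}^3$, $i=0,1,3,4$, be symmetric with respect to one of the coordinate planes $Oxy$, $Oxz$, $Oyz$; that is, denoting by $\sigma$ the reflection of $\mathbb{R}^3$ in that plane, $\sigma(\mathbf{b}_{0k})=\mathbf{b}_{4k}$ and $\sigma(\mathbf{b}_{1k})=\mathbf{b}_{3k}$ for $k=0,4$, and $\sigma(\mathbf{b}_{20})=\mathbf{b}_{20}$. Then the corresponding harmonic bi-quartic Bézier surface (the one having these nine points among its control points, with the remaining sixteen control points given by the formulas in the context) is symmetric with respect to the same plane, i.e. its image $\mathbf{x}([0,1]^2)$ is invariant under $\sigma$.
   Context: $B_i^4(t)=\binom{4}{i}t^i(1-t)^{4-i}$, $i=0,\dots,4$, $0\le t\le 1$, are the Bernstein polynomials of degree $4$. A bi-quartic (tensor product) Bézier surface with control points $\mathbf{b}_{ij}\in\mathbb{R}^3$, $i,j=0,\dots,4$, is the map $\mathbf{x}(u,v)=\sum_{i=0}^4\sum_{j=0}^4\mathbf{b}_{ij}B_i^4(u)B_j^4(v)$ on $0\le u,v\le 1$. It is harmonic if $\Delta\mathbf{x}=\mathbf{x}_{uu}+\mathbf{x}_{vv}=0$ identically. The harmonic Bézier surface corresponding to given control points $\mathbf{b}_{i0}$ ($i=0,\dots,4$) and $\mathbf{b}_{i4}$ ($i=0,1,3,4$) is the one whose remaining sixteen control points are $$\begin{array}{rcl} \mathbf{b}_{01}&=&(25\mathbf{b}_{00}+8\mathbf{b}_{04}-40\mathbf{b}_{10}-8\mathbf{b}_{14}+36\mathbf{b}_{20}-16\mathbf{b}_{30}+4\mathbf{b}_{34}+4\mathbf{b}_{40}-\mathbf{b}_{44})/12,\\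 \mathbf{b}_{41}&=&(4\mathbf{b}_{00}-\mathbf{b}_{04}-16\mathbf{b}_{10}+4\mathbf{b}_{14}+36\mathbf{b}_{20}-40\mathbf{b}_{30}-8\mathbf{b}_{34}+25\mathbf{b}_{40}+8\mathbf{b}_{44})/12,\\ \mathbf{b}_{11}&=&(17\mathbf{b}_{00}+7\mathbf{b}_{04}-14\mathbf{b}_{10}-4\mathbf{b}_{14}+18\mathbf{b}_{20}-8\mathbf{b}_{30}+2\mathbf{b}_{34}+5\mathbf{b}_{40}+\mathbf{b}_{44})/24,\\ \mathbf{b}_{31}&=&(5\mathbf{b}_{00}+\mathbf{b}_{04}-8\mathbf{b}_{10}+2\mathbf{b}_{14}+18\mathbf{b}_{20}-14\mathbf{b}_{30}-4\mathbf{b}_{34}+17\mathbf{b}_{40}+7\mathbf{b}_{44})/24,\\ \mathbf{b}_{02}&=&(13\mathbf{b}_{00}+8\mathbf{b}_{04}-28\mathbf{b}_{10}-8\mathbf{b}_{14}+30\mathbf{b}_{20}-16\mathbf{b}_{30}+4\mathbf{b}_{34}+4\mathbf{b}_{40}-\mathbf{b}_{44})/6,\\ \mathbf{b}_{42}&=&(4\mathbf{b}_{00}-\mathbf{b}_{04}-16\mathbf{b}_{10}+4\mathbf{b}_{14}+30\mathbf{b}_{20}-28\mathbf{b}_{30}-8\mathbf{b}_{34}+13\mathbf{b}_{40}+8\mathbf{b}_{44})/6,\\ \mathbf{b}_{12}&=&(11\mathbf{b}_{00}+7\mathbf{b}_{04}-20\mathbf{b}_{10}-4\mathbf{b}_{14}+24\mathbf{b}_{20}-14\mathbf{b}_{30}+2\mathbf{b}_{34}+5\mathbf{b}_{40}+\mathbf{b}_{44})/12,\\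 \mathbf{b}_{32}&=&(5\mathbf{b}_{00}+\mathbf{b}_{04}-14\mathbf{b}_{10}+2\mathbf{b}_{14}+24\mathbf{b}_{20}-20\mathbf{b}_{30}-4\mathbf{b}_{34}+11\mathbf{b}_{40}+7\mathbf{b}_{44})/12,\\ \mathbf{b}_{03}&=&(14\mathbf{b}_{00}+19\mathbf{b}_{04}-32\mathbf{b}_{10}-16\mathbf{b}_{14}+36\mathbf{b}_{20}-20\mathbf{b}_{30}+8\mathbf{b}_{34}+5\mathbf{b}_{40}-2\mathbf{b}_{44})/12,\\ \mathbf{b}_{43}&=&(5\mathbf{b}_{00}-2\mathbf{b}_{04}-20\mathbf{b}_{10}+8\mathbf{b}_{14}+36\mathbf{b}_{20}-32\mathbf{b}_{30}-16\mathbf{b}_{34}+14\mathbf{b}_{40}+19\mathbf{b}_{44})/12,\\ \mathbf{b}_{13}&=&(5\mathbf{b}_{00}+7\mathbf{b}_{04}-8\mathbf{b}_{10}-\mathbf{b}_{14}+9\mathbf{b}_{20}-5\mathbf{b}_{30}+2\mathbf{b}_{34}+2\mathbf{b}_{40}+\mathbf{b}_{44})/12,\\ \mathbf{b}_{33}&=&(2\mathbf{b}_{00}+\mathbf{b}_{04}-5\mathbf{b}_{10}+2\mathbf{b}_{14}+9\mathbf{b}_{20}-8\mathbf{b}_{30}-\mathbf{b}_{34}+5\mathbf{b}_{40}+7\mathbf{b}_{44})/12,\\ \mathbf{b}_{21}&=&(3\mathbf{b}_{00}+\mathbf{b}_{04}-4\mathbf{b}_{10}+8\mathbf{b}_{20}-4\mathbf{b}_{30}+3\mathbf{b}_{40}+\mathbf{b}_{44})/8,\\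 \mathbf{b}_{22}&=&(7\mathbf{b}_{00}+3\mathbf{b}_{04}-16\mathbf{b}_{10}+24\mathbf{b}_{20}-16\mathbf{b}_{30}+7\mathbf{b}_{40}+3\mathbf{b}_{44})/12,\\ \mathbf{b}_{23}&=&(7\mathbf{b}_{00}+5\mathbf{b}_{04}-16\mathbf{b}_{10}+4\mathbf{b}_{14}+24\mathbf{b}_{20}-16\mathbf{b}_{30}+4\mathbf{b}_{34}+7\mathbf{b}_{40}+5\mathbf{b}_{44})/24,\\ \mathbf{b}_{24}&=&(\mathbf{b}_{00}-\mathbf{b}_{04}-4\mathbf{b}_{10}+4\mathbf{b}_{14}+6\mathbf{b}_{20}-4\mathbf{b}_{30}+4\mathbf{b}_{34}+\mathbf{b}_{40}-\mathbf{b}_{44})/6. \end{array}$$ *)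

(* Defs.v *)
From mathcomp Require Import all_boot all_order all_algebra.
From mathcomp Require Import all_classical all_reals.

Set Implicit Arguments.
Unset Strict Implicit.
Unset Printing Implicit Defensive.

Import GRing.Theory.
Local Open Scope classical_set_scope.
Local Open Scope ring_scope.

Definition bernstein (R : realType) (n i : nat) (t : R) : R :=
  'C(n, i)%:R * t ^+ i * (1 - t) ^+ (n - i).

Definition biquartic_bezier (R : realType) (b : 'I_5 -> 'I_5 -> 'rV[R]_3)
    (u v : R) : 'rV[R]_3 :=
  \sum_(i < 5) \sum_(j < 5) (bernstein 4 i u * bernstein 4 j v) *: b i j.

Definition biquartic_bezier_image (R : realType)
    (b : 'I_5 -> 'I_5 -> 'rV[R]_3) : set 'rV[R]_3 :=
  [set biquartic_bezier b uv.1 uv.2 | uv in `[0, 1] `*` `[0, 1]].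

(* The solution of the linear system on the control points expressing
   x_uu + x_vv = 0, in terms of the nine points b_i0 (i = 0, .., 4) and
   b_i4 (i = 0, 1, 3, 4); in particular b_24 is not free.
   The last branch is unreachable. *)
Definition harmonic_control_points (R : realType)
    (b00 b10 b20 b30 b40 b04 b14 b34 b44 : 'rV[R]_3)
    (i j : 'I_5) : 'rV[R]_3 :=
  match nat_of_ord i, nat_of_ord j with
  | 0%N, 0%N => b00
  | 1%N, 0%N => b10
  | 2%N, 0%N => b20
  | 3%N, 0%N => b30
  | 4%N, 0%N => b40
  | 0%N, 4%N => b04
  | 1%N, 4%N => b14
  | 3%N, 4%N => b34
  | 4%N, 4%N => b44
  | 0%N, 1%N => 12^-1 *: (25 *: b00 + 8 *: b04 - 40 *: b10 - 8 *: b14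
      + 36 *: b20 - 16 *: b30 + 4 *: b34 + 4 *: b40 - b44)
  | 4%N, 1%N => 12^-1 *: (4 *: b00 - b04 - 16 *: b10 + 4 *: b14
      + 36 *: b20 - 40 *: b30 - 8 *: b34 + 25 *: b40 + 8 *: b44)
  | 1%N, 1%N => 24^-1 *: (17 *: b00 + 7 *: b04 - 14 *: b10 - 4 *: b14
      + 18 *: b20 - 8 *: b30 + 2 *: b34 + 5 *: b40 + b44)
  | 3%N, 1%N => 24^-1 *: (5 *: b00 + b04 - 8 *: b10 + 2 *: b14
      + 18 *: b20 - 14 *: b30 - 4 *: b34 + 17 *: b40 + 7 *: b44)
  | 0%N, 2%N => 6^-1 *: (13 *: b00 + 8 *: b04 - 28 *: b10 - 8 *: b14
      + 30 *: b20 - 16 *: b30 + 4 *: b34 + 4 *: b40 - b44)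
  | 4%N, 2%N => 6^-1 *: (4 *: b00 - b04 - 16 *: b10 + 4 *: b14
      + 30 *: b20 - 28 *: b30 - 8 *: b34 + 13 *: b40 + 8 *: b44)
  | 1%N, 2%N => 12^-1 *: (11 *: b00 + 7 *: b04 - 20 *: b10 - 4 *: b14
      + 24 *: b20 - 14 *: b30 + 2 *: b34 + 5 *: b40 + b44)
  | 3%N, 2%N => 12^-1 *: (5 *: b00 + b04 - 14 *: b10 + 2 *: b14
      + 24 *: b20 - 20 *: b30 - 4 *: b34 + 11 *: b40 + 7 *: b44)
  | 0%N, 3%N => 12^-1 *: (14 *: b00 + 19 *: b04 - 32 *: b10 - 16 *: b14
      + 36 *: b20 - 20 *: b30 + 8 *: b34 + 5 *: b40 - 2 *: b44)
  | 4%N, 3%N => 12^-1 *: (5 *: b00 - 2 *: b04 - 20 *: b10 + 8 *: b14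
      + 36 *: b20 - 32 *: b30 - 16 *: b34 + 14 *: b40 + 19 *: b44)
  | 1%N, 3%N => 12^-1 *: (5 *: b00 + 7 *: b04 - 8 *: b10 - b14
      + 9 *: b20 - 5 *: b30 + 2 *: b34 + 2 *: b40 + b44)
  | 3%N, 3%N => 12^-1 *: (2 *: b00 + b04 - 5 *: b10 + 2 *: b14
      + 9 *: b20 - 8 *: b30 - b34 + 5 *: b40 + 7 *: b44)
  | 2%N, 1%N => 8^-1 *: (3 *: b00 + b04 - 4 *: b10 + 8 *: b20
      - 4 *: b30 + 3 *: b40 + b44)
  | 2%N, 2%N => 12^-1 *: (7 *: b00 + 3 *: b04 - 16 *: b10 + 24 *: b20
      - 16 *: b30 + 7 *: b40 + 3 *: b44)
  | 2%N, 3%N => 24^-1 *: (7 *: b00 + 5 *: b04 - 16 *: b10 + 4 *: b14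
      + 24 *: b20 - 16 *: b30 + 4 *: b34 + 7 *: b40 + 5 *: b44)
  | 2%N, 4%N => 6^-1 *: (b00 - b04 - 4 *: b10 + 4 *: b14
      + 6 *: b20 - 4 *: b30 + 4 *: b34 + b40 - b44)
  | _, _ => 0
  end.

Inductive coordinate_plane : Set := Oxy | Oxz | Oyz.

Definition normal_axis (P : coordinate_plane) : 'I_3 :=
  match P with
  | Oxy => @Ordinal 3 2 isT
  | Oxz => @Ordinal 3 1 isT
  | Oyz => @Ordinal 3 0 isT
  end.

Definition reflection (R : realType) (P : coordinate_plane) (p : 'rV[R]_3) :
    'rV[R]_3 :=
  \row_k (if k == normal_axis P then - p 0 k else p 0 k).

(* Main.v *)
Require Import Defs.
From HB Require Import structures.
From mathcomp Require Import all_boot all_order all_algebra.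
From mathcomp Require Import all_classical all_reals.
From mathcomp Require Import lra.

Import Order.TTheory GRing.Theory Num.Theory.

Local Open Scope classical_set_scope.
Local Open Scope ring_scope.

(** The symmetry comes from reversing the parameter [u].  The nine given points
    are permuted by the reflection [s] according to [i |-> 4 - i], and the
    formulas for the sixteen other points are linear and compatible with this
    exchange, so [s] maps the whole control net to the net with reversed first
    index ([reflection_harmonic_control_points]).  Bernstein polynomials satisfy
    [B_(4-i)(u) = B_i(1 - u)] ([bernstein_rev]), hence reversing the net
    amounts to replacing [u] by [1 - u] ([biquartic_bezier_rev]).  As [s] is
    linear, it commutes with the Bezier map, so that [s x(u,v) = x(1 - u,v)].
    Since [u |-> 1 - u] preserves the unit interval, [s] maps the image into
    itself; being an involution, it maps the image onto itself. *)

Lemma reflection_is_linear (R : realType) (P : coordinate_plane) :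
  linear (@reflection R P).
Proof.
move=> a p q; apply/rowP => k; rewrite !mxE.
by case: ifP => // _; rewrite opprD mulrN.
Qed.

HB.instance Definition _ (R : realType) (P : coordinate_plane) :=
  GRing.isLinear.Build R 'rV[R]_3 'rV[R]_3 _ (@reflection R P)
    (@reflection_is_linear R P).

Lemma reflectionK (R : realType) (P : coordinate_plane) :
  involutive (@reflection R P).
Proof.
by move=> p; apply/rowP => k; rewrite !mxE; case: eqP; rewrite ?opprK.
Qed.

Lemma bernstein_rev (R : realType) (n : nat) (i : 'I_n.+1) (t : R) :
  bernstein n (rev_ord i) t = bernstein n i (1 - t).
Proof.
have le_in : (i <= n)%N by rewrite -ltnS.
by rewrite /bernstein /= subSS bin_sub // subKn // subKr mulrAC.
Qed.

Lemma biquartic_bezier_rev (R : realType) (b : 'I_5 -> 'I_5 -> 'rV[R]_3)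
    (u v : R) :
  biquartic_bezier (fun i j => b (rev_ord i) j) u v =
  biquartic_bezier b (1 - u) v.
Proof.
rewrite /biquartic_bezier [RHS](reindex_inj rev_ord_inj) /=.
apply: eq_bigr => i _; apply: eq_bigr => j _.
by rewrite bernstein_rev subKr.
Qed.

Lemma reflection_biquartic_bezier (R : realType) (P : coordinate_plane)
    (b : 'I_5 -> 'I_5 -> 'rV[R]_3) (u v : R) :
  reflection P (biquartic_bezier b u v) =
  biquartic_bezier (fun i j => reflection P (b i j)) u v.
Proof.
rewrite /biquartic_bezier linear_sum; apply: eq_bigr => i _.
by rewrite linear_sum; apply: eq_bigr => j _; rewrite linearZ.
Qed.

(** An inclusion suffices because the reflection is its own inverse. *)
Lemma reflection_biquartic_bezier_image (R : realType) (P : coordinate_plane)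
    (b : 'I_5 -> 'I_5 -> 'rV[R]_3)
    (b_sym : forall i j, reflection P (b i j) = b (rev_ord i) j) :
  reflection P @` biquartic_bezier_image b = biquartic_bezier_image b.
Proof.
have stable p : biquartic_bezier_image b p ->
    biquartic_bezier_image b (reflection P p).
  move=> [[u v] /= [u01 v01] <-].
  exists (1 - u, v) => /=.
    split=> //; move: u01; rewrite /= !in_itv /= => /andP[u0 u1].
    by apply/andP; split; lra.
  rewrite -biquartic_bezier_rev reflection_biquartic_bezier.
  by congr biquartic_bezier; apply/funext => i; apply/funext => j.
apply/seteqP; split=> [_ [p Sp <-]|p Sp]; first exact: stable.
by exists (reflection P p); [exact: stable | exact: reflectionK].
Qed.

(** In each coordinate the reflection is multiplication by [1] or by [-1], so
    that the claim splits into linear consequences of the five hypotheses. *)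
Lemma reflection_harmonic_control_points (R : realType) (P : coordinate_plane)
    (b00 b10 b20 b30 b40 b04 b14 b34 b44 : 'rV[R]_3)
    (h0 : reflection P b00 = b40) (h1 : reflection P b10 = b30)
    (h2 : reflection P b20 = b20)
    (h3 : reflection P b04 = b44) (h4 : reflection P b14 = b34) (i j : 'I_5) :
  let b := harmonic_control_points b00 b10 b20 b30 b40 b04 b14 b34 b44 in
  reflection P (b i j) = b (rev_ord i) j.
Proof.
move=> b; apply/rowP => k.
move: h0 h1 h2 h3 h4 => /rowP/(_ k) + /rowP/(_ k) + /rowP/(_ k) +
  /rowP/(_ k) + /rowP/(_ k).
rewrite !mxE /b /harmonic_control_points.
case: ifP => _ e0 e1 e2 e3 e4;
  case: i => -[|[|[|[|[|i]]]]] //= _; case: j => -[|[|[|[|[|j]]]]] //= _;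
  rewrite ?mxE; lra.
Qed.

Theorem proposition1 (R : realType) (P : coordinate_plane)
    (b00 b10 b20 b30 b40 b04 b14 b34 b44 : 'rV[R]_3)
    (h0 : reflection P b00 = b40) (h1 : reflection P b10 = b30)
    (h2 : reflection P b20 = b20)
    (h3 : reflection P b04 = b44) (h4 : reflection P b14 = b34) :
  let S := biquartic_bezier_image
    (harmonic_control_points b00 b10 b20 b30 b40 b04 b14 b34 b44) in
  reflection P @` S = S.
Proof.
apply: reflection_biquartic_bezier_image => i j.
exact: reflection_harmonic_control_points.
Qed.
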